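(* Let $H$ be a $(0,1,2)$-multigraph of order $n\ge 3$ with exactly two distinct main eigenvalues whose $B$-graph is the cycle $C_n$, and let $a,b$ be integers such that $a\,d(v)+b=s(v)$ for every $v\in V(H)$. Label the vertices as follows: if $n$ is even, $V(H)=\{u_1,\dots,u_{n/2},v_1,\dots,v_{n/2}\}$ with $u_1u_2\cdots u_{n/2}v_{n/2}\cdots v_2v_1u_1$ the cycle of the $B$-graph; if $n$ is odd, $V(H)=\{u_1,\dots,u_{(n-1)/2},v_1,\dots,v_{(n-1)/2},x\}$ with $u_1\cdots u_{(n-1)/2}\,x\,v_{(n-1)/2}\cdots v_1u_1$ the cycle; and assume $w(u_1,v_1)=2$. If $w(u_1,u_2)=1$ and $w(v_1,v_2)=1$, then $H$ is isomorphic to $U^1_{4t}$ or to $U^2_{3t}$ for some $t\ge 1$.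
   Context: A $(0,1,2)$-multigraph $H$ is a loopless multigraph in which any two distinct vertices $u,v$ are joined by $w(u,v)\in\{0,1,2\}$ edges; its adjacency matrix has $(u,v)$-entry $w(u,v)$. The degree is $d(v)=\sum_u w(u,v)$ and $s(v)=\sum_{u\sim v}w(u,v)d(u)$. The $B$-graph of $H$ is the simple graph on $V(H)$ with $u\sim v$ iff $w(u,v)\ge1$. An eigenvalue of the adjacency matrix is main if its eigenspace is not orthogonal to the all-ones vector. For $n_1\ge1,n_2\ge0,t\ge1$, $[n_1,n_2]_t$ denotes the $(0,1,2)$-multigraph on $x_0,\dots,x_{N-1}$, $N=(n_1+n_2)t$, whose edges join $x_i$ and $x_{i+1\bmod N}$ with multiplicity $2$ if $(i\bmod(n_1+n_2))<n_1$ and $1$ otherwise (around the cycle: $n_1$ consecutive double edges then $n_2$ consecutive single edges, repeated $t$ times). $U^1_{4t}=[1,3]_t$ and $U^2_{3t}=[1,2]_t$. *)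

(* Defs.v *)
From HB Require Import structures.
From mathcomp Require Import all_boot all_order all_algebra.
From mathcomp Require Import zify.
From mathcomp Require Import reals.

Set Implicit Arguments.
Unset Strict Implicit.
Unset Printing Implicit Defensive.

Import Order.TTheory GRing.Theory Num.Theory.

Local Open Scope ring_scope.

(* A multigraph on V is given by its multiplicity function w : V -> V -> nat. *)
Section Multigraphs.
Variable V : finType.
Implicit Type w : V -> V -> nat.

Definition mg012 w : Prop :=
  [/\ forall u v, w u v = w v u,
      forall v, w v v = 0%N
    & forall u v, (w u v <= 2)%N].

Definition Bgraph w : rel V := fun u v => (1 <= w u v)%N.

Definition degree w (v : V) : nat := (\sum_u w u v)%N.

Definition sdegree w (v : V) : nat :=
  (\sum_(u | Bgraph w u v) w u v * degree w u)%N.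

(* The vertices are ordered by the enumeration of V. *)
Definition adjmx (R : realType) w : 'M[R]_#|V| :=
  \matrix_(i, j) (w (enum_val i) (enum_val j))%:R.

End Multigraphs.

(* v *m const_mx 1 is the scalar product of the row vector v with the all-ones
   vector; the left eigenvectors of [eigenspace] are the usual ones since
   adjacency matrices are symmetric. *)
Definition main_eigenvalue (R : realType) (n : nat) (A : 'M[R]_n) (mu : R) :
    Prop :=
  eigenvalue A mu /\
  ~ (forall v : 'rV[R]_n, (v <= eigenspace A mu)%MS ->
       v *m (const_mx 1 : 'cV[R]_n) = 0).

Definition exactly_two_main_eigenvalues (R : realType) (n : nat)
    (A : 'M[R]_n) : Prop :=
  exists mu1 mu2 : R, mu1 <> mu2 /\
    forall mu, main_eigenvalue A mu <-> mu = mu1 \/ mu = mu2.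

Definition cycle_graph (n : nat) : rel 'I_n :=
  fun i j => (val j == i.+1 %% n)%N || (val i == j.+1 %% n)%N.

Definition graph_iso (V V' : finType) (e : rel V) (e' : rel V') : Prop :=
  exists2 f : V -> V', bijective f & forall x y, e' (f x) (f y) = e x y.

Definition multigraph_iso (V V' : finType) (w : V -> V -> nat)
    (w' : V' -> V' -> nat) : Prop :=
  exists2 f : V -> V', bijective f & forall x y, w' (f x) (f y) = w x y.

Definition hamiltonian_cycle (V : finType) (e : rel V) (s : seq V) : Prop :=
  ucycle e s /\ forall y, y \in s.

(* The labelling u_1, ..., u_k, v_1, ..., v_k (k = n./2), together with x when n
   is odd; the cycle is u_1 ... u_k v_k ... v_1 for even n and
   u_1 ... u_k x v_k ... v_1 for odd n. For odd n the first unused labels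
   u_(k+1) and v_(k+1) both stand for x; this matters only when n = 3, where it
   gives u_2 and v_2 a meaning. *)
Definition cycle_labelling (V : finType) (e : rel V) (n : nat)
    (u v : nat -> V) : Prop :=
  let us := [seq u i | i <- iota 1 n./2] in
  let vs := [seq v i | i <- iota 1 n./2] in
  if odd n then
    exists x : V, [/\ u n./2.+1 = x, v n./2.+1 = x
                    & hamiltonian_cycle e (us ++ x :: rev vs)]
  else hamiltonian_cycle e (us ++ rev vs).

Definition bracket_mult (n1 n2 i : nat) : nat :=
  if (i %% (n1 + n2) < n1)%N then 2%N else 1%N.

(* [n1, n2]_t: the edge from x_i to its cyclic successor has multiplicity
   bracket_mult n1 n2 i. At most one summand is nonzero once (n1 + n2) * t >= 3;
   the degenerate cycles of length at most 2 are not (0,1,2)-multigraphs in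
   general. *)
Definition bracket (n1 n2 t : nat) (i j : 'I_((n1 + n2) * t)) : nat :=
  ((if val j == i.+1 %% ((n1 + n2) * t) then bracket_mult n1 n2 i else 0) +
   (if val i == j.+1 %% ((n1 + n2) * t) then bracket_mult n1 n2 j else 0))%N.

Definition U1 (t : nat) := @bracket 1 3 t.
Definition U2 (t : nat) := @bracket 1 2 t.

Lemma succ_modE (n i : nat) : (i < n)%N ->
  (i.+1 %% n = if i.+1 == n then 0 else i.+1)%N.
Proof.
move=> lt_in; case: eqP => [->|ne]; first by rewrite modnn.
by rewrite modn_small //; lia.
Qed.

Lemma bracket_mg012 (n1 n2 t : nat) :
  (3 <= (n1 + n2) * t)%N -> mg012 (@bracket n1 n2 t).
Proof.
rewrite /bracket; move: ((n1 + n2) * t)%N => n n3; split=> [i j|i|i j].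
- by rewrite addnC.
- have lt_in := ltn_ord i; rewrite succ_modE //=.
  by do ![case: ifP => //] => *; lia.
- have := (ltn_ord i, ltn_ord j) => -[lt_in lt_jn].
  rewrite !succ_modE //= /bracket_mult.
  by do ![case: ifP => //] => *; lia.
Qed.

(* Main.v *)
Require Import Defs.
From HB Require Import structures.
From mathcomp Require Import all_boot all_order all_algebra.
From mathcomp Require Import zify.
From mathcomp Require Import reals.

Set Implicit Arguments.
Unset Strict Implicit.

Import Order.TTheory GRing.Theory Num.Theory.

(** Walk around the cycle and let [m i] be the multiplicity of its [i]-th edge.
    The relation [a d + b = s] at a vertex involves four consecutive
    multiplicities and determines the last one from the first three. Starting
    from [1, 2, 1] there are three possible continuations:
    [1, 2, 1, 2, ...], which makes the multigraph regular and hence leaves it a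
    single main eigenvalue; [1, 2, 1, 1, 2, ...], which propagates with period
    3; and [1, 2, 1, 1, 1, ...], which propagates with period 4. Since [m] also
    has period [n], the period 3 or 4 divides [n]. *)

Local Open Scope ring_scope.

(** * Regular multigraphs and main eigenvalues *)

(** Evaluating [z *m A *m const_mx 1] in two ways for an eigenvector [z] gives [mu] and [r] times
    the same scalar product, which therefore vanishes unless [mu = r]. *)
Lemma main_eigenvalue_const_row_sum (R : realType) (n : nat) (A : 'M[R]_n)
    (r mu : R) :
  A *m (const_mx 1 : 'cV[R]_n) = r *: const_mx 1 ->
  main_eigenvalue A mu -> mu = r.
Proof.
move=> A1 [_ main_mu]; apply/eqP/negPn/negP => mu_neq_r; apply: main_mu => z.
move=> /eigenspaceP zA.
have := congr1 (mulmx z) A1; rewrite mulmxA zA -scalemxAl -scalemxAr.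
move/eqP; rewrite -subr_eq0 -scalerBl scaler_eq0 subr_eq0 (negPf mu_neq_r).
by move/eqP.
Qed.

Lemma regular_not_two_main (R : realType) (V : finType) (w : V -> V -> nat)
    (r : nat) :
  (forall y z, w y z = w z y) -> (forall y, degree w y = r) ->
  ~ exactly_two_main_eigenvalues (adjmx R w).
Proof.
move=> w_sym w_reg [mu1 [mu2 [mu12 main_iff]]]; apply: mu12.
have w1 : adjmx R w *m (const_mx 1 : 'cV[R]_#|V|) = r%:R *: const_mx 1.
  apply/matrixP => i j; rewrite !mxE mulr1 -(w_reg (enum_val i)) /degree natr_sum.
  rewrite [RHS](big_enum_val (fun y : V => (w y (enum_val i))%:R)) /=.
  by apply: eq_bigr => k _; rewrite !mxE mulr1 w_sym.
have mainE mu : mu = mu1 \/ mu = mu2 -> mu = r%:R.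
  by move=> /main_iff; apply: main_eigenvalue_const_row_sum.
by apply: etrans (mainE mu1 _) (esym (mainE mu2 _)); [left | right].
Qed.

Local Close Scope ring_scope.
Local Open Scope nat_scope.

(** * Walking around the cycle *)

Lemma cycle_graph_two_neighbours (n : nat) (i j k l : 'I_n) :
  cycle_graph i j -> cycle_graph i k -> cycle_graph i l ->
  j != k -> l = j \/ l = k.
Proof.
have [[[ltin ltjn] ltkn] ltln] := (ltn_ord i, ltn_ord j, ltn_ord k, ltn_ord l).
rewrite /cycle_graph !succ_modE // -!val_eqE /= => ij ik il jk.
suff : val l = val j \/ val l = val k by case=> /val_inj ->; auto.
move: ij ik il; do ![case: ifP => ?] => /=; lia.
Qed.

Lemma cycle_nth_modn (V : eqType) (e : rel V) (x0 : V) (s : seq V) (i : nat) :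
  0 < size s -> cycle e s ->
  e (nth x0 s (i %% size s)) (nth x0 s (i.+1 %% size s)).
Proof.
case: s => // y p _ /= /(pathP x0); rewrite size_rcons => e_path.
have lt_i : i %% (size p).+1 < (size p).+1 by rewrite ltn_mod.
have := e_path _ lt_i; rewrite -rcons_cons nth_rcons lt_i nth_rcons.
have -> : i.+1 %% (size p).+1 = (i %% (size p).+1).+1 %% (size p).+1.
  by rewrite -addn1 -modnDml addn1.
(* The last index is separate: its step is the edge that closes the cycle. *)
rewrite succ_modE // eqSS; move: lt_i; rewrite ltnS leq_eqVlt.
by case: eqP => [->|_ /= lt_i]; rewrite ?ltnn ?eqxx ?lt_i.
Qed.

(** Indexing by all naturals lets the walk turn endlessly, which spares modular indices. The last
    clause says that there are no edges besides those of the walk; it is stated at [i.+1] so that a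
    predecessor always exists. *)
Definition winding (V : finType) (w : V -> V -> nat) (n : nat) (x : nat -> V) :=
  [/\ forall i j, x i = x j <-> i = j %[mod n],
      forall y, exists2 i, i < n & y = x i,
      forall i, 0 < w (x i) (x i.+1)
    & forall i y, 0 < w (x i.+1) y -> y = x i \/ y = x i.+2].

(** A vertex of the n-cycle has only two neighbours, and [s] already supplies two distinct ones, so
    no edge lies off [s]. *)
Lemma hamiltonian_winding (V : finType) (w : V -> V -> nat) (n : nat) (x0 : V)
    (s : seq V) :
  #|V| = n -> 3 <= n -> (forall y z, w y z = w z y) ->
  graph_iso (Bgraph w) (@cycle_graph n) ->
  hamiltonian_cycle (Bgraph w) s ->
  winding w n (fun i => nth x0 s (i %% n)) /\ size s = n.
Proof.
move=> cardV n_ge3 w_sym [f f_bij fE] [/andP[cyc_s uniq_s] mem_s].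
have size_s : size s = n.
  rewrite -(card_uniqP uniq_s) -cardV.
  by apply: eq_card => y; rewrite mem_s.
have n_gt0 : 0 < n by lia.
split=> //.
have xE i j : nth x0 s (i %% n) = nth x0 s (j %% n) <-> i = j %[mod n].
  split=> [/eqP|->] //.
  by rewrite nth_uniq ?size_s ?ltn_mod // => /eqP.
have step i : 0 < w (nth x0 s (i %% n)) (nth x0 s (i.+1 %% n)).
  by rewrite -size_s; apply: (@cycle_nth_modn _ (Bgraph w)); rewrite ?size_s.
split=> // [y|i y w_iy].
  exists (index y s); first by rewrite -size_s index_mem.
  by rewrite modn_small ?nth_index // -size_s index_mem.
have f_inj := bij_inj f_bij.
have := @cycle_graph_two_neighbours n (f (nth x0 s (i.+1 %% n)))
  (f (nth x0 s (i %% n))) (f (nth x0 s (i.+2 %% n))) (f y).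
rewrite !fE /Bgraph (w_sym _ (nth x0 s (i %% n))) !step w_iy (inj_eq f_inj).
case=> //; last 2 first; try by move=> /f_inj ->; auto.
(* The two neighbours differ because 2 is not 0 modulo n when n is at least 3. *)
apply/eqP => /xE /eqP; rewrite -{1}[i]addn0 -addn2 eqn_modDl.
by rewrite !modn_small.
Qed.

Section Winding.

Context (V : finType) (w : V -> V -> nat) (n : nat) (x : nat -> V).
Hypotheses (hw : mg012 w) (n_ge3 : 3 <= n) (wind : winding w n x).

Let m i := w (x i) (x i.+1).

(** Only the two cyclic neighbours contribute. Taking for [F] the constant 1 or the degree yields
    both d and s. *)
Lemma winding_sum (F : V -> nat) (i : nat) :
  \sum_y w y (x i.+1) * F y = m i * F (x i) + m i.+1 * F (x i.+2).
Proof.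
have [[w_sym _ _] [xE _ _ nbr]] := (hw, wind).
have x_neq : x i.+2 != x i.
  apply/eqP => /xE /eqP; rewrite -{2}[i]addn0 -addn2 eqn_modDl.
  by rewrite mod0n modn_small.
rewrite (bigD1 (x i)) //= (bigD1 (x i.+2)) //= big1 ?addn0 /m.
  by rewrite (w_sym (x i.+2)).
move=> y /andP[y_i y_i2]; apply/eqP; rewrite muln_eq0 -leqn0 leqNgt w_sym.
by apply/orP; left; apply/negP => /nbr[] y_eq; rewrite y_eq eqxx in y_i y_i2.
Qed.

Lemma winding_periodic (k i : nat) : x (k * n + i) = x i.
Proof. by have [xE _ _ _] := wind; apply/xE; rewrite modnMDl. Qed.

Lemma winding_degree (i : nat) : degree w (x i.+1) = m i + m i.+1.
Proof.
rewrite -[m i]muln1 -[m i.+1]muln1 -(winding_sum (fun=> 1)) /degree.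
by apply: eq_bigr => y _; rewrite muln1.
Qed.

Lemma winding_sdegree (i : nat) :
  sdegree w (x i.+2) = m i.+1 * (m i + m i.+1) + m i.+2 * (m i.+2 + m i.+3).
Proof.
rewrite -!winding_degree -winding_sum /sdegree big_mkcond /=.
by apply: eq_bigr => y _; rewrite /Bgraph; case: (w y _).
Qed.

Lemma winding_bracket_iso (n1 n2 t : nat) :
  (n1 + n2) * t = n -> (forall i, m i = bracket_mult n1 n2 i) ->
  multigraph_iso w (@bracket n1 n2 t).
Proof.
move=> nE mE; have [[w_sym _ _] [xE x_onto _ nbr]] := (hw, wind).
have n_gt0 : 0 < n by lia.
have x_ex y : exists i : 'I_((n1 + n2) * t), y == x i.
  have [i lt_in ->] := x_onto y; rewrite -nE in lt_in.
  by exists (Ordinal lt_in).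
pose f y := xchoose (x_ex y).
have fK : cancel f (fun i => x i).
  by move=> y; apply/esym/eqP/(xchooseP (x_ex y)).
have Kf : cancel (fun i : 'I_((n1 + n2) * t) => x i) f.
  move=> i; apply: val_inj => /=; have /xE := fK (x i).
  have [lt1 lt2] := (ltn_ord i, ltn_ord (f (x i))).
  by rewrite !modn_small -?nE.
exists f; first exact: Bijective fK Kf.
move=> y z; rewrite -{2}[y]fK -{2}[z]fK; move: (f y) (f z) => i j {y z}.
have lt_i : i < n by rewrite -nE.
have lt_j : j < n by rewrite -nE.
rewrite /bracket /=; move: (nat_of_ord i) (nat_of_ord j) lt_i lt_j.
move=> {}i {}j lt_i lt_j; rewrite nE -!mE.
have x_mod k : x (k %% n) = x k by apply/xE; rewrite modn_mod.
have eq_mod (k l : nat) : k < n -> x k = x l -> k = l %% n.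
  by move=> lt_k /xE; rewrite modn_small.
case: eqP => [ji|ji]; case: eqP => [ij|ij]; rewrite ?addn0 ?add0n.
(* Two indices cannot be cyclic successors of each other once n is at least 3. *)
- by exfalso; move: ji ij; rewrite !succ_modE //; do ![case: ifP => ?]; lia.
- by rewrite /m ji x_mod.
- by rewrite w_sym /m ij x_mod.
- apply/esym/eqP; rewrite -leqn0 leqNgt; apply/negP => w_ij.
  (* Going once around exhibits [x i] as a successor, as the neighbour clause of [winding]
     requires. *)
  have iE : x i = x (n.-1 + i).+1.
    by rewrite -(winding_periodic 1) mul1n -addSn prednK.
  rewrite iE in w_ij; case: (nbr _ _ w_ij) => jE.
  + apply: ij; apply: eq_mod => //; rewrite iE; apply/xE.
    apply/eqP; rewrite -addn1 -[j.+1]addn1 eqn_modDr; apply/eqP/xE.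
    by rewrite jE.
  + apply: ji; apply: eq_mod => //; rewrite jE; apply/xE.
    by rewrite -addnS -addSn prednK // -[n in n + _]mul1n modnMDl.
Qed.

End Winding.

(** * The recurrence for the multiplicities *)

Lemma recurrence_unique (c : nat -> nat -> nat -> nat -> Prop)
    (m p : nat -> nat) :
  (forall q r s t t', c q r s t -> c q r s t' -> 0 < s -> t = t') ->
  (forall i, 0 < p i) ->
  (forall i, c (m i) (m i.+1) (m i.+2) (m i.+3)) ->
  (forall i, c (p i) (p i.+1) (p i.+2) (p i.+3)) ->
  m 0 = p 0 -> m 1 = p 1 -> m 2 = p 2 -> m =1 p.
Proof.
move=> c_det p_gt0 cm cp m0 m1 m2 i.
suff [] : [/\ m i = p i, m i.+1 = p i.+1 & m i.+2 = p i.+2] by [].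
elim: i => [//|i [e0 e1 e2]]; split=> //.
have := cm i; rewrite e0 e1 e2 => cmi.
exact: c_det cmi (cp i) (p_gt0 _).
Qed.

(** The vertex lies between the edges of multiplicities [r] and [s]: its degree is [r + s], and its
    neighbours have degrees [q + r] and [s + t]. *)
Definition vertex_relation (a b : int) (q r s t : nat) : Prop :=
  (a * (r + s)%:Z + b = (r * (q + r) + s * (s + t))%:Z)%R.

Lemma vertex_relation_det (a b : int) (q r s t t' : nat) :
  vertex_relation a b q r s t -> vertex_relation a b q r s t' -> 0 < s -> t = t'.
Proof.
rewrite /vertex_relation => -> /eqP; rewrite eqz_nat eqn_add2l => /eqP e s_gt0.
by apply/eqP; move/eqP: e; rewrite eqn_pmul2l // eqn_add2l.
Qed.

Lemma multiplicity_trichotomy (a b : int) (m : nat -> nat) :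
  (forall i, 0 < m i <= 2) ->
  (forall i, vertex_relation a b (m i) (m i.+1) (m i.+2) (m i.+3)) ->
  m 0 = 1 -> m 1 = 2 -> m 2 = 1 ->
  [\/ forall i, m i + m i.+1 = 3,
      forall i, m i.+1 = bracket_mult 1 3 i
    | forall i, m i.+1 = bracket_mult 1 2 i].
Proof.
move=> m12 rel m0 m1 m2.
have uniq p := @recurrence_unique (vertex_relation a b) m p
  (@vertex_relation_det a b).
have m3_12 : m 3 = 1 \/ m 3 = 2 by have := m12 3; lia.
have m4_12 : m 4 = 1 \/ m 4 = 2 by have := m12 4; lia.
have [r0 r1] := (rel 0, rel 1).
rewrite /vertex_relation m0 m1 m2 in r0 r1.
case: m3_12 => m3; rewrite m3 in r0 r1.
(* Now 3a + b = 8 and 2a + b = 4 + [m 4], so (a, b) is (3, -1) or (2, 2). *)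
- case: m4_12 => m4; rewrite m4 in r1.
  (* The sequence [m] starts one edge before a double edge, and 3 is -1 modulo the period 4; the
     shifts in the other cases arise likewise. *)
  + apply: Or32; pose p i := bracket_mult 1 3 (i + 3).
    have mE : m =1 p.
      apply: uniq => // [i|i]; first by rewrite /p /bracket_mult; case: ifP.
      rewrite /vertex_relation /p /bracket_mult.
      by do ![case: ifP => ?]; lia.
    by move=> i; rewrite mE /p /bracket_mult addSnnS modnDr.
  + apply: Or33; pose p i := bracket_mult 1 2 (i + 2).
    have mE : m =1 p.
      apply: uniq => // [i|i]; first by rewrite /p /bracket_mult; case: ifP.
      rewrite /vertex_relation /p /bracket_mult.
      by do ![case: ifP => ?]; lia.
    by move=> i; rewrite mE /p /bracket_mult addSnnS modnDr.
(* Only 3a + b = 9 is known here; it suffices, since every vertex relation of the alternating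
   candidate reads so. *)
- apply: Or31; pose p i := bracket_mult 1 1 i.+1.
  have mE : m =1 p.
    apply: uniq => // [i|i]; first by rewrite /p /bracket_mult; case: ifP.
    rewrite /vertex_relation /p /bracket_mult.
    by do ![case: ifP => ?]; lia.
  by move=> i; rewrite !mE /p /bracket_mult; do ![case: ifP => ?]; lia.
Qed.

(** Each period has a single double edge, at its start. *)
Lemma bracket_mult_dvdn (k n : nat) : bracket_mult 1 k n = 2 -> (1 + k) %| n.
Proof. by rewrite /bracket_mult /dvdn; case: ifP => //; rewrite ltnS leqn0. Qed.

(** * From the labelling to the classification *)

(** Rotating the cycle by one puts [v 1] in front, with [u 1], [u 2] after it and [v 2] at the end,
    whatever the parity of n. *)
Lemma labelling_cycle (V : finType) (e : rel V) (n : nat) (u v : nat -> V) :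
  3 <= n -> cycle_labelling e n u v ->
  exists s : seq V, [/\ hamiltonian_cycle e s, nth (v 1) s 0 = v 1,
    nth (v 1) s 1 = u 1, nth (v 1) s 2 = u 2 & nth (v 1) s (size s).-1 = v 2].
Proof.
have rot1 (c : seq V) y : hamiltonian_cycle e (rcons c y) ->
    hamiltonian_cycle e (y :: c).
  rewrite -rotr1_rcons => -[/andP[cyc uniq_c] mem_c].
  split; last by move=> z; rewrite mem_rotr.
  by rewrite /ucycle rotr_cycle cyc rotr_uniq.
rewrite /cycle_labelling => n_ge3.
pose us l := [seq u i | i <- iota 3 l].
pose vs l := rev [seq v i | i <- iota 3 l].
(* Here [mid] is empty for even n and holds the vertex x for odd n; n = 3, where [u 2] and [v 2]
   coincide, is done by hand. *)
have long (mid : seq V) l :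
    hamiltonian_cycle e
      ([:: u 1, u 2 & us l] ++ mid ++ rcons (rcons (vs l) (v 2)) (v 1)) ->
  exists s : seq V, [/\ hamiltonian_cycle e s, nth (v 1) s 0 = v 1,
    nth (v 1) s 1 = u 1, nth (v 1) s 2 = u 2 & nth (v 1) s (size s).-1 = v 2].
  rewrite -!rcons_cat => /rot1 ham.
  exists (v 1 :: rcons ([:: u 1, u 2 & us l] ++ mid ++ vs l) (v 2)).
  by split=> //; rewrite nth_last /= last_rcons.
have half_gt0 : 0 < n./2 by lia.
case: ifP => n_odd.
  case=> y [uy vy]; move: half_gt0 uy vy; case: n./2 => [//|[|l]] _ uy vy /=.
    move=> /(rot1 [:: u 1; y]) ham; exists [:: v 1; u 1; y].
    by split=> //=; rewrite ?uy ?vy.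
  by rewrite !rev_cons -cat1s => /(long [:: y] l).
move: half_gt0; case kE: n./2 => [//|[|l]] _ /=; first by lia.
by rewrite !rev_cons => /(long [::] l).
Qed.

Local Open Scope ring_scope.

Theorem theorem3p5 (R : realType) (V : finType) (w : V -> V -> nat) (n : nat)
    (a b : int) (u v : nat -> V)
    (hw : mg012 w)
    (hn : #|V| = n)
    (hn3 : (3 <= n)%N)
    (hmain : exactly_two_main_eigenvalues (adjmx R w))
    (hB : graph_iso (Bgraph w) (@cycle_graph n))
    (hab : forall y : V, a * (degree w y)%:Z + b = (sdegree w y)%:Z)
    (hlab : cycle_labelling (Bgraph w) n u v)
    (huv1 : w (u 1%N) (v 1%N) = 2%N)
    (hu : w (u 1%N) (u 2%N) = 1%N)
    (hv : w (v 1%N) (v 2%N) = 1%N) :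
  exists2 t : nat, (1 <= t)%N &
    multigraph_iso w (@U1 t) \/ multigraph_iso w (@U2 t).
Proof.
have [w_sym _ w_le2] := hw.
have [s [ham_s s0 s1 s2 s_last]] := labelling_cycle hn3 hlab.
have [wind size_s] := hamiltonian_winding (v 1) hn hn3 w_sym hB ham_s.
set x := fun i : nat => nth (v 1%N) s (i %% n) in wind.
have [xE x_onto step _] := wind.
pose m i := w (x i) (x i.+1).
have x_n i : x (n + i)%N = x i by rewrite -[n]mul1n (winding_periodic wind).
have x0 : x 0%N = v 1%N by rewrite /x mod0n.
have x1 : x 1%N = u 1%N by rewrite /x modn_small //; lia.
have x2 : x 2%N = u 2%N by rewrite /x modn_small //; lia.
have x_last : x n.-1 = v 2%N by rewrite /x modn_small -?size_s //; lia.
(* [m'] is [m] started one edge earlier, at the edge from v_2 to v_1. *)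
pose m' i := m (n.-1 + i)%N.
have nE : n.-1.+1 = n by lia.
have m'S i : m' i.+1 = m i by rewrite /m' -addSnnS nE /m -addnS !x_n.
have m'0 : m' 0%N = 1%N.
  by rewrite /m' /m addn0 nE x_last -[n in x n]addn0 x_n x0 w_sym.
have m_per k : (forall i, m' i.+1 = bracket_mult 1 k i) ->
    exists2 t : nat, (1 <= t)%N & multigraph_iso w (@bracket 1 k t).
  move=> m'E; have mE i : m i = bracket_mult 1 k i by rewrite -m'S m'E.
  (* After n steps the walk is back at the double edge from [v 1] to [u 1]. *)
  have /dvdnP[t nt] : (1 + k %| n)%N.
    apply: bracket_mult_dvdn; rewrite -mE /m -addn1 -{1}[n]addn0 !x_n.
    by rewrite x0 x1 w_sym.
  exists t; first by case: t nt => // nt; lia.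
  by apply: (winding_bracket_iso hw hn3 wind) => //; rewrite mulnC.
have [||||reg|/m_per|/m_per] := @multiplicity_trichotomy a b m' _ _ m'0.
- by move=> i; rewrite /m' step w_le2.
- move=> i; rewrite /vertex_relation /m' !addnS.
  by rewrite -(winding_sdegree hw hn3 wind) -(winding_degree hw hn3 wind) hab.
- by rewrite m'S /m x0 x1 w_sym.
- by rewrite m'S /m x1 x2.
(* Consecutive multiplicities add up to the degree of the vertex between them, so all degrees are
   3. *)
- exfalso; apply: (@regular_not_two_main R V w 3) hmain => // y.
  have [i _ ->] := x_onto y; rewrite -x_n -nE addSn.
  by rewrite (winding_degree hw hn3 wind); have := reg i; rewrite /m' addnS.
- by case=> t t_gt0 iso; exists t => //; left.
- by case=> t t_gt0 iso; exists t => //; right.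
Qed.
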